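(* Let $N\ge 2$, $A\in\mathbb{R}^{n\times n}$, $B\in\mathbb{R}^{n\times m}$, and suppose that all eigenvalues of $A$ lie on the unit circle and that $(A,B)$ is reachable. Let $\{\mathcal{L}(k)\}_{k\ge 0}$ be the Laplacian matrices of a time-varying digraph on $N$ nodes such that, for some $\overline{\mu}>0$, $\mathcal{L}(k)+\mathcal{L}(k)'\ge\overline{\mu}\,\mathcal{L}(k)'\mathcal{L}(k)$ for all $k\ge 0$, and let $0<\mu<\overline{\mu}$. Let $\gamma>1$ and $\varepsilon_\gamma>0$ be such that the algebraic Riccati equation $$X=A'X[I+(1-\gamma^{-2})BB'X]^{-1}A+\varepsilon_\gamma I$$ admits the stabilizing solution $X>0$ satisfying $B'XB<\gamma^2 I$, and let $$F=[I+(1-\gamma^{-2})B'XB]^{-1}B'XA,$$ where $F$ is stabilizing (i.e. $A-BF$ is Schur stable) and achieves $\|T_F\|_{\mathcal{H}_\infty}<\gamma$ with $T_F(z)=F(zI-A+BF)^{-1}B$. Suppose there exist an integer $T_{\rm c}>0$ and a real number $\epsilon>0$ such that, along the trajectories of the closed-loop system $$\widehat{x}(k+1)=[I_{N-1}\otimes A-\mu\,\widehat{\mathcal{L}}(k)\otimes(BF)]\,\widehat{x}(k),\qquad \widehat{y}(k)=(I_{N-1}\otimes F)\,\widehat{x}(k),$$ one has $$\sum_{k=0}^{T_{\rm c}}\|\widehat{\mathcal{L}}_m(k_0+k)\,\widehat{y}(k_0+k)\|^2\ \ge\ \epsilon\sum_{k=0}^{T_{\rm c}}\|\widehat{y}(k_0+k)\|^2\quad\text{for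 all } k_0\ge 0,$$ and $\gamma\sqrt{1-\epsilon\mu(\overline{\mu}-\mu)}\le 1$. Then the feedback multi-agent system $$x(k+1)=[I_N\otimes A-\mu\,\mathcal{L}(k)\otimes(BF)]\,x(k)$$ achieves the state consensus.
   Context: Notation: $'$ denotes transpose, $\otimes$ the Kronecker product, $\|\cdot\|$ the Euclidean norm; inequalities between symmetric matrices are in the positive (semi)definite order. A square matrix is Schur stable if all its eigenvalues lie strictly inside the unit circle. For a stable transfer matrix $T(z)$, $\|T\|_{\mathcal{H}_\infty}:=\sup_{|z|>1}\overline{\sigma}[T(z)]$, with $\overline{\sigma}$ the maximum singular value. A symmetric solution $X$ of the Riccati equation is stabilizing if $[I+(1-\gamma^{-2})BB'X]^{-1}A$ is Schur stable. Multi-agent system: there are $N$ agents $x_i(k+1)=Ax_i(k)+Bu_i(k)$, $x_i(0)=x_{i0}$, with $x_i(k)\in\mathbb{R}^n$, $u_i(k)\in\mathbb{R}^m$, $i\in\{1,\dots,N\}$, under the control protocol $u_i(k)=-\mu F\sum_{j=1}^N a_{i,j}(k)[x_i(k)-x_j(k)]$. Here $a_{i,j}(k)\ge 0$ is the edge gain at time $k$ from node $j$ to node $i$, with $a_{i,i}(k)=0$. The Laplacian matrix $\mathcal{L}(k)\in\mathbb{R}^{N\times N}$ has off-diagonal entries $-a_{i,j}(k)$ and diagonal entries $\sum_j a_{i,j}(k)$ (so each row sums to zero). The global state is the stacked vector $x(k)=\mathrm{vec}\{x_1(k),\dots,x_N(k)\}$. State consensus: $\lim_{k\to\infty}[x_i(k)-x_j(k)]=0$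 for all $i,j\in\{1,\dots,N\}$ (for all initial conditions). Dimension reduced quantities: let $v_1=\frac{1}{\sqrt N}(1,\dots,1)'\in\mathbb{R}^N$, choose $v_2,\dots,v_N$ so that $\{v_i\}_{i=1}^N$ is an orthonormal basis of $\mathbb{R}^N$, and put $\widehat{V}=[v_2\ \cdots\ v_N]\in\mathbb{R}^{N\times(N-1)}$, $\widehat{\mathcal{L}}(k)=\widehat{V}'\mathcal{L}(k)\widehat{V}$, $\widehat{\mathcal{L}}_m(k)=\widehat{\mathcal{L}}(k)\otimes I_m$, and $\widehat{x}(k)=(\widehat{V}'\otimes I_n)x(k)$. The constants $T_{\rm c}$ and $\epsilon$ are the same for all trajectories $\widehat{x}$ (all initial conditions $\widehat{x}(0)$). *)

(* Defs.v *)
From mathcomp Require Import all_boot all_order all_algebra.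
From mathcomp Require Import complex mxtens.
From mathcomp Require Import all_classical all_reals all_analysis.

Set Implicit Arguments.
Unset Strict Implicit.
Unset Printing Implicit Defensive.

Import Order.TTheory GRing.Theory Num.Theory.
Import numFieldNormedType.Exports.

Local Open Scope classical_set_scope.
Local Open Scope ring_scope.
Local Open Scope sesquilinear_scope.

Section Matrices.
Variable R : realType.

Definition enorm n (v : 'cV[R]_n) : R := Num.sqrt (\sum_i v i 0 ^+ 2).

Definition psd n (M : 'M[R]_n) : Prop :=
  M^T = M /\ forall v : 'cV[R]_n, 0 <= (v^T *m M *m v) 0 0.

Definition pd n (M : 'M[R]_n) : Prop :=
  M^T = M /\ forall v : 'cV[R]_n, v != 0 -> 0 < (v^T *m M *m v) 0 0.

Definition loewner_le n (M P : 'M[R]_n) : Prop := psd (P - M).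
Definition loewner_lt n (M P : 'M[R]_n) : Prop := pd (P - M).

Definition cmx m n (M : 'M[R]_(m, n)) : 'M[R[i]]_(m, n) :=
  map_mx (real_complex R) M.

(* Eigenvalues of real matrices are the complex ones; as `|z| is a real element
   of R[i], the comparison with 1 in R[i] is the comparison of moduli. *)
Definition schur_stable n (M : 'M[R]_n) : Prop :=
  forall z : R[i], eigenvalue (cmx M) z -> `|z| < 1.

Definition spectrum_on_unit_circle n (M : 'M[R]_n) : Prop :=
  forall z : R[i], eigenvalue (cmx M) z -> `|z| = 1.

Definition singular_value m n (M : 'M[R[i]]_(m, n)) (s : R) : Prop :=
  0 <= s /\ eigenvalue (M^t* *m M) (real_complex R (s ^+ 2)).

(* The set of singular values is finite, and empty only when n = 0, in which
   case sup set0 = 0. *)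
Definition sigma_max m n (M : 'M[R[i]]_(m, n)) : R :=
  sup [set s | singular_value M s].

(* Extended-real valued, so that an unbounded T gets norm +oo. *)
Definition Hinf_norm m n (T : R[i] -> 'M[R[i]]_(m, n)) : \bar R :=
  ereal_sup [set (sigma_max (T z))%:E | z in [set z : R[i] | 1 < `|z|]].

End Matrices.

Section Control.
Variable R : realType.

Definition trajectory n (M : nat -> 'M[R]_n) (x : nat -> 'cV[R]_n) : Prop :=
  forall k, x k.+1 = M k *m x k.

Fixpoint state_from0 n m (A : 'M[R]_n) (B : 'M[R]_(n, m))
    (u : nat -> 'cV[R]_m) (k : nat) : 'cV[R]_n :=
  if k is k'.+1 then A *m state_from0 A B u k' + B *m u k' else 0.

Definition reachable n m (A : 'M[R]_n) (B : 'M[R]_(n, m)) : Prop :=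
  forall xf : 'cV[R]_n, exists (k : nat) (u : nat -> 'cV[R]_m),
    state_from0 A B u k = xf.

(* For 1 < gamma and X positive definite (the only case used) the matrix
   inverted here, and the one inverted in [riccati_gain], are invertible, so the
   default value of [invmx] plays no role. *)
Definition riccati_closed_loop n m (A : 'M[R]_n) (B : 'M[R]_(n, m))
    (gamma : R) (X : 'M[R]_n) : 'M[R]_n :=
  invmx (1%:M + (1 - gamma ^- 2) *: (B *m B^T *m X)) *m A.

Definition stabilizing_riccati_solution n m (A : 'M[R]_n) (B : 'M[R]_(n, m))
    (gamma eps_gamma : R) (X : 'M[R]_n) : Prop :=
  [/\ X^T = X,
      X = A^T *m X *m riccati_closed_loop A B gamma X + eps_gamma%:M &
      schur_stable (riccati_closed_loop A B gamma X)].

Definition riccati_gain n m (A : 'M[R]_n) (B : 'M[R]_(n, m))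
    (gamma : R) (X : 'M[R]_n) : 'M[R]_(m, n) :=
  invmx (1%:M + (1 - gamma ^- 2) *: (B^T *m X *m B)) *m B^T *m X *m A.

Definition transfer_matrix n m (A : 'M[R]_n) (B : 'M[R]_(n, m))
    (F : 'M[R]_(m, n)) (z : R[i]) : 'M[R[i]]_m :=
  cmx F *m invmx (z%:M - cmx A + cmx B *m cmx F) *m cmx B.

End Control.

Section Network.
Variable R : realType.

(* a i j is the gain of the edge from node j to node i *)
Definition edge_gains N (a : 'M[R]_N) : Prop :=
  (forall i j, 0 <= a i j) /\ (forall i, a i i = 0).

Definition laplacian N (a : 'M[R]_N) : 'M[R]_N :=
  \matrix_(i, j) (if i == j then \sum_l a i l else - a i j).

(* Orthonormality of the N columns of [v_1 Vhat], with v_1 = (1,...,1)'/sqrt N;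
   being N in number in R^N, they form a basis. *)
Definition orthonormal_completion N (Vhat : 'M[R]_(N, N.-1)) : Prop :=
  let V := row_mx (const_mx (Num.sqrt N%:R)^-1 : 'cV[R]_N) Vhat in
  V^T *m V = 1%:M.

Definition reduced_laplacian N (Vhat : 'M[R]_(N, N.-1)) (L : 'M[R]_N) :
  'M[R]_N.-1 := Vhat^T *m L *m Vhat.

Definition network_mx p n m (A : 'M[R]_n) (B : 'M[R]_(n, m))
    (F : 'M[R]_(m, n)) (mu : R) (L : 'M[R]_p) : 'M[R]_(p * n) :=
  tensmx 1%:M A - mu *: tensmx L (B *m F).

(* i-th block of the stacked vector vec{x_1, ..., x_N} *)
Definition agent N n (x : 'cV[R]_(N * n)) (i : 'I_N) : 'cV[R]_n :=
  \col_j x (mxtens_index (i, j)) 0.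

Definition state_consensus N n (M : nat -> 'M[R]_(N * n)) : Prop :=
  forall x : nat -> 'cV[R]_(N * n), trajectory M x ->
  forall i j : 'I_N,
    (fun k => agent (x k) i - agent (x k) j) @ \oo --> (0 : 'cV[R]_n).

End Network.

(* Main.v *)
Require Import Defs.
From mathcomp Require Import all_boot all_order all_algebra.
From mathcomp Require Import complex mxtens.
From mathcomp Require Import all_classical all_reals all_analysis.
From mathcomp Require Import ring lra.

Set Implicit Arguments.
Unset Strict Implicit.
Unset Printing Implicit Defensive.

Import Order.TTheory GRing.Theory Num.Theory.
Import numFieldNormedType.Exports.

Local Open Scope ring_scope.

(** The disagreement part of the network is a linear system under a feedback
    that loses gain on average, and the solution [X] of the Riccati equation is
    a Lyapunov function for it over time windows.

    Projecting the stacked state along the consensus direction gives the reduced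
    state [xhat]; since every Laplacian annihilates the constant vector, [xhat]
    obeys the reduced recursion by itself, and consensus means that [xhat] tends
    to 0.  With [yhat = F xhat] and [w = yhat - mu Lhat yhat], the reduced
    recursion reads [xhat(k+1) = (A - B F) xhat(k) + B w(k)], block by block.
    Three inequalities close the argument.

    - Completing the square in the linear-quadratic game whose value function is
      [xhat' X xhat] ([riccati_dissipation]), the increase of [xhat' X xhat] in
      one step is at most
      [- eps_gamma |xhat|^2 - |yhat|^2 + gamma^2 |w|^2].  This is a gain bound
      for [A - B F] read off in the time domain, with a strict margin in [xhat].

    - From [mubar L'L <= L + L'], which survives the reduction
      ([loewner_reduced]), [|w|^2 <= |yhat|^2 - mu (mubar - mu) |Lhat yhat|^2]
      ([coupling_gain]).

    - Summed over a window of length [Tc + 1], the excitation hypothesis turns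
      this into [sum |w|^2 <= (1 - eps mu (mubar - mu)) sum |yhat|^2], and the
      condition on [gamma] makes [gamma^2 sum |w|^2 <= sum |yhat|^2].

    So [xhat' X xhat] decreases over each window by at least
    [eps_gamma sum |xhat|^2], and since it is nonnegative the series of
    [|xhat(k)|^2] converges ([windowed_dissipation_cvg0]).

    A stacked vector is handled as the matrix whose columns are the agents:
    Kronecker products become two-sided multiplications, and sums over agents
    become traces. *)

(** * Quadratic forms on matrices *)

Section QuadraticForms.
Variable R : realType.

(** The squared Frobenius norm, as a trace so that matrix algebra applies to it. *)
Definition frob2 p q (M : 'M[R]_(p, q)) : R := \tr (M^T *m M).

Lemma frob2E p q (M : 'M[R]_(p, q)) : frob2 M = \sum_i \sum_j M i j ^+ 2.
Proof.
rewrite /frob2 /mxtrace exchange_big /=; apply: eq_bigr => j _.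
by rewrite mxE; apply: eq_bigr => i _; rewrite mxE expr2.
Qed.

Lemma frob2_ge0 p q (M : 'M[R]_(p, q)) : 0 <= frob2 M.
Proof.
by rewrite frob2E; apply: sumr_ge0 => i _; apply: sumr_ge0 => j _; rewrite sqr_ge0.
Qed.

Lemma sqr_entry_le_frob2 p q (M : 'M[R]_(p, q)) i j : M i j ^+ 2 <= frob2 M.
Proof.
rewrite frob2E (bigD1 i) //= (bigD1 j) //= -addrA lerDl addr_ge0 //.
  by apply: sumr_ge0 => *; rewrite sqr_ge0.
by apply: sumr_ge0 => *; apply: sumr_ge0 => *; rewrite sqr_ge0.
Qed.

Lemma frob2_tr p q (M : 'M[R]_(p, q)) : frob2 M^T = frob2 M.
Proof. by rewrite /frob2 trmxK mxtrace_mulC. Qed.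

Lemma frob2_subZ p q (c : R) (M P : 'M[R]_(p, q)) :
  frob2 (M - c *: P) = frob2 M - 2 * c * \tr (M^T *m P) + c ^+ 2 * frob2 P.
Proof.
rewrite /frob2; have -> : (M - c *: P)^T = M^T - c *: P^T by rewrite linearB linearZ.
rewrite mulmxBl !mulmxBr -!scalemxAl -!scalemxAr !raddfB /= !mxtraceZ.
rewrite (_ : \tr (P^T *m M) = \tr (M^T *m P)); first by ring.
by rewrite -mxtrace_tr trmx_mul trmxK.
Qed.

Lemma frob2_mul_isometry p q r (M : 'M[R]_(p, q)) (V : 'M[R]_(r, q)) :
  V^T *m V = 1%:M -> frob2 (M *m V^T) = frob2 M.
Proof.
move=> VV; rewrite /frob2 trmx_mul trmxK mxtrace_mulC -mulmxA [V^T *m _]mulmxA VV.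
by rewrite mul1mx mxtrace_mulC.
Qed.

Lemma enorm_sqr n (v : 'cV[R]_n) : enorm v ^+ 2 = \sum_i v i 0 ^+ 2.
Proof. by rewrite sqr_sqrtr // sumr_ge0 // => i _; rewrite sqr_ge0. Qed.

Lemma pd_psd n (Q : 'M[R]_n) : pd Q -> psd Q.
Proof.
case=> Qs Qp; split=> // v; have [->|v0] := eqVneq v 0; last exact: ltW (Qp v v0).
by rewrite mulmx0 mxE.
Qed.

(** The trace adds up the values of the form at the columns of [Z]. *)
Lemma psd_mxtrace_ge0 p n (Q : 'M[R]_n) (Z : 'M[R]_(n, p)) :
  psd Q -> 0 <= \tr (Z^T *m Q *m Z).
Proof.
case=> _ Qp; apply: sumr_ge0 => j _; have := Qp (col j Z).
rewrite tr_col -row_mul [in leRHS]mxE => le0; rewrite mxE.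
rewrite (le_trans le0) // le_eqVlt; apply/orP; left; apply/eqP.
by apply: eq_bigr => k _; rewrite mxE [col j Z k 0]mxE.
Qed.

Lemma psdD n (P Q : 'M[R]_n) : psd P -> psd Q -> psd (P + Q).
Proof.
move=> [Ps Pp] [Qs Qp]; split; first by rewrite linearD /= Ps Qs.
by move=> v; rewrite mulmxDr mulmxDl mxE addr_ge0.
Qed.

Lemma psdZ n (c : R) (P : 'M[R]_n) : 0 <= c -> psd P -> psd (c *: P).
Proof.
move=> c0 [Ps Pp]; split; first by rewrite linearZ /= Ps.
by move=> v; rewrite -scalemxAr -scalemxAl mxE mulr_ge0.
Qed.

Lemma psd_congr n p (P : 'M[R]_n) (M : 'M[R]_(n, p)) :
  psd P -> psd (M^T *m P *m M).
Proof.
move=> [Ps Pp]; split; first by rewrite !trmx_mul trmxK Ps mulmxA.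
by move=> v; have := Pp (M *m v); rewrite trmx_mul !mulmxA.
Qed.

Lemma psd_gram n p (M : 'M[R]_(p, n)) : psd (M^T *m M).
Proof.
split; first by rewrite trmx_mul trmxK.
move=> v; have := frob2_ge0 (M *m v).
by rewrite /frob2 trmx_mul !mulmxA /mxtrace big_ord1.
Qed.

Lemma pd_unitmx n (Q : 'M[R]_n) : pd Q -> Q \in unitmx.
Proof.
move=> [Qs Qp]; rewrite -row_free_unit -kermx_eq0; apply/eqP/row_matrixP => i.
rewrite row0; apply/eqP; case: eqVneq => // k0.
have /Qp : (row i (kermx Q))^T != 0.
  by apply: contra k0 => /eqP k0; rewrite -[row _ _]trmxK k0 trmx0.
by rewrite trmxK -row_mul mulmx_ker row0 mul0mx mxE ltxx.
Qed.

End QuadraticForms.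

(** * The Riccati equation and its dissipation inequality *)

Section Riccati.
Variables (R : realType) (n m : nat) (A : 'M[R]_n) (B : 'M[R]_(n, m)).
Variables (gamma eps : R) (X : 'M[R]_n).
Hypotheses (gamma1 : 1 < gamma) (Xpsd : psd X).

Let c : R := 1 - gamma ^- 2.
Let F := riccati_gain A B gamma X.

Let c_ge0 : 0 <= c.
Proof.
by rewrite /c subr_ge0 invf_le1 ?exprn_gt0 ?exprn_ege1 // ?(lt_trans _ gamma1) // ltW.
Qed.

Lemma riccati_gain_denom_unit : 1%:M + c *: (B^T *m X *m B) \in unitmx.
Proof.
apply: pd_unitmx; have [Ps Pp] := psdZ c_ge0 (psd_congr B Xpsd).
split; first by rewrite linearD /= trmx1 Ps.
move=> v v0; rewrite mulmxDr mulmxDl mxE mulmx1 ltr_pwDl //.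
have -> : (v^T *m v) 0 0 = frob2 v by rewrite /frob2 /mxtrace big_ord1.
rewrite lt0r frob2_ge0 andbT; apply: contra v0 => /eqP v0; apply/eqP/matrixP => i j.
apply/eqP; rewrite mxE -sqrf_eq0 eq_le sqr_ge0 andbT -v0.
exact: sqr_entry_le_frob2.
Qed.

Lemma riccati_gainE : F + c *: (B^T *m X *m B *m F) = B^T *m X *m A.
Proof.
rewrite scalemxAl -[X in X + _]mul1mx -mulmxDl /F /riccati_gain !mulmxA.
by rewrite mulmxV ?riccati_gain_denom_unit // mul1mx.
Qed.

(** By the push-through identity [(I + c B B' X) B = B (I + c B' X B)], the
    inverse in the closed loop reduces to the one in the gain.  In game terms,
    [A - c B F] is the loop under the optimal control [u = - F x] and the worst
    disturbance [w = gamma^-2 F x]. *)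
Lemma riccati_closed_loopE : riccati_closed_loop A B gamma X = A - c *: (B *m F).
Proof.
rewrite /riccati_closed_loop -/c.
set E := 1%:M + _; set S := 1%:M + c *: (B^T *m X *m B).
have EB : E *m B = B *m S.
  by rewrite mulmxDl mulmxDr mul1mx mulmx1 -scalemxAl -scalemxAr !mulmxA.
have EU : E \in unitmx.
  suff /mulmx1_unit[] : E *m (1%:M - c *: (B *m invmx S *m B^T *m X)) = 1%:M by [].
  rewrite mulmxBr mulmx1 -scalemxAr !mulmxA EB mulmxK ?riccati_gain_denom_unit //.
  by rewrite -!mulmxA /E !mulmxA addrK.
rewrite -[RHS](mulKmx EU); congr (_ *m _); rewrite mulmxBr -scalemxAr mulmxA EB.
have SF : S *m F = B^T *m X *m A.
  by rewrite mulmxDl mul1mx -scalemxAl riccati_gainE.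
by rewrite -mulmxA SF mulmxDl mul1mx -scalemxAl !mulmxA addrK.
Qed.

Lemma riccati_gain_closed_loop : B^T *m X *m (A - c *: (B *m F)) = F.
Proof. by rewrite mulmxBr -scalemxAr mulmxA -riccati_gainE addrK. Qed.

Hypothesis riccati : X = A^T *m X *m riccati_closed_loop A B gamma X + eps%:M.
Hypothesis BXB : psd ((gamma ^+ 2)%:M - B^T *m X *m B).

(** Completing the square in the linear-quadratic game: relative to the worst
    disturbance [gamma^-2 F x], a disturbance contributes a term in the form
    [gamma^2 I - B' X B], which is nonnegative.  So the quadratic form of [X]
    certifies the gain bound [gamma] for the loop [A - B F] in the time domain.
    The columns of [Z] and [W] are independent copies of state and input. *)
Lemma riccati_dissipation p (Z Z1 : 'M[R]_(n, p)) (W : 'M[R]_(m, p)) :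
  Z1 = (A - B *m F) *m Z + B *m W ->
  \tr (Z1^T *m X *m Z1) <=
  \tr (Z^T *m X *m Z) - eps * frob2 Z - frob2 (F *m Z) + gamma ^+ 2 * frob2 W.
Proof.
move=> Z1def; set M := A - c *: (B *m F); set Y := F *m Z.
(* D is the deviation from the worst disturbance. *)
pose D := W - gamma ^- 2 *: Y.
have Xs := Xpsd.1.
have WE : W = D + gamma ^- 2 *: Y by rewrite subrK.
have Z1E : Z1 = M *m Z + B *m D.
  rewrite Z1def WE mulmxDr -scalemxAr /M /c /Y !mulmxBl scalerBl scale1r mulmxBl.
  by rewrite -scalemxAl !mulmxA opprB !addrA; apply/matrixP => i j; rewrite !mxE; ring.
have FE : B^T *m X *m M = F := riccati_gain_closed_loop.
have MXM : M^T *m X *m M = X - eps%:M - c *: (F^T *m F).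
  have -> : M^T = A^T - c *: (F^T *m B^T) by rewrite linearB linearZ /= trmx_mul.
  rewrite {2}riccati riccati_closed_loopE -/c -/M addrK !mulmxBl -!scalemxAl.
  by rewrite -3!mulmxA [B^T *m _]mulmxA FE mulmxA.
clearbody F M D.
have e1 : \tr ((M *m Z)^T *m X *m (M *m Z)) =
    \tr (Z^T *m X *m Z) - eps * frob2 Z - c * frob2 Y.
  rewrite trmx_mul (_ : _ *m _ = Z^T *m (M^T *m X *m M) *m Z); last by rewrite !mulmxA.
  rewrite MXM !mulmxBr !mulmxBl !linearB /= mul_mx_scalar -scalemxAr -!scalemxAl.
  by rewrite !linearZ /= /frob2 /Y trmx_mul !mulmxA.
have e2 : \tr ((B *m D)^T *m X *m (M *m Z)) = \tr (D^T *m Y).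
  by rewrite trmx_mul -!mulmxA [B^T *m _]mulmxA [B^T *m X *m _]mulmxA FE.
have e3 : \tr ((M *m Z)^T *m X *m (B *m D)) = \tr (D^T *m Y).
  by rewrite -e2 -mxtrace_tr !trmx_mul !trmxK Xs !mulmxA.
have e4 : \tr ((B *m D)^T *m X *m (B *m D)) <= gamma ^+ 2 * frob2 D.
  have := psd_mxtrace_ge0 D BXB.
  rewrite mulmxBr mulmxBl linearB /= mul_mx_scalar -scalemxAl linearZ /= subr_ge0.
  by rewrite trmx_mul !mulmxA.
have g0 : gamma != 0 by rewrite gt_eqF // (lt_trans _ gamma1).
have e5 : frob2 W = frob2 D + 2 * gamma ^- 2 * \tr (D^T *m Y) + gamma ^- 4 * frob2 Y.
  by rewrite WE -[_ *: Y]opprK -scaleNr frob2_subZ; field.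
have -> : \tr (Z1^T *m X *m Z1) =
    \tr (Z^T *m X *m Z) - eps * frob2 Z - c * frob2 Y + 2 * \tr (D^T *m Y)
    + \tr ((B *m D)^T *m X *m (B *m D)).
  rewrite Z1E [(_ + _)^T]linearD /= !(mulmxDl, mulmxDr) !mxtraceD e1 e2 e3; ring.
rewrite e5 (_ : _ + gamma ^+ 2 * _ = \tr (Z^T *m X *m Z) - eps * frob2 Z - c * frob2 Y
    + 2 * \tr (D^T *m Y) + gamma ^+ 2 * frob2 D); first by rewrite lerD2l.
by rewrite /c; field.
Qed.

End Riccati.

(** * Convergence from windowed dissipation *)

Section WindowedDissipation.
Variables (R : realType) (e : R) (V x s : nat -> R).
Hypotheses (V_ge0 : forall k, 0 <= V k) (x_ge0 : forall k, 0 <= x k).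
Hypothesis dissipation : forall k, V k.+1 <= V k - e * x k + s k.

Lemma dissipation_sum k0 t :
  V (k0 + t)%N + e * \sum_(0 <= k < t) x (k0 + k)%N
    <= V k0 + \sum_(0 <= k < t) s (k0 + k)%N.
Proof.
elim: t => [|t IHt]; first by rewrite !big_geq // mulr0 addn0.
rewrite !big_nat_recr //= addnS mulrDr.
by have := dissipation (k0 + t); lra.
Qed.

(** The supply [s] may be positive at single times: telescoping over the first
    [K] windows bounds the partial sums of [x] at the times [K * T], and
    nonnegativity of [x] fills in the times between. *)
Lemma windowed_dissipation_cvg0 T : (0 < T)%N -> 0 < e ->
  (forall k0, \sum_(0 <= k < T) s (k0 + k)%N <= 0) ->
  (x @ \oo --> (0 : R))%classic.
Proof.
move=> T0 e0 window.
have bound K : e * \sum_(0 <= k < K * T) x k <= V 0%N - V (K * T)%N.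
  elim: K => [|K IHK]; first by rewrite mul0n big_geq // mulr0 subrr.
  rewrite mulSnr (@big_cat_nat _ _ _ (K * T)) ?leq_addr //= mulrDr.
  rewrite -{2}[(K * T)%N]add0n big_addn addKn.
  under [X in _ + e * X]eq_bigr do rewrite addnC.
  by have := dissipation_sum (K * T) T; have := window (K * T)%N; lra.
apply: cvg_series_cvg_0; apply: nondecreasing_is_cvgn.
  by apply/nondecreasing_seqP => k; rewrite /series /= big_nat_recr //= lerDl.
exists (V 0%N / e) => _ [k _ <-]; rewrite ler_pdivlMr // mulrC /series /=.
apply: (@le_trans _ _ (e * \sum_(0 <= i < k * T) x i)).
  rewrite ler_pM2l // (@big_cat_nat _ _ _ k _ (k * T)) ?leq_pmulr //= lerDl.
  by apply: sumr_ge0.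
by rewrite (le_trans (bound k)) // gerBl.
Qed.

End WindowedDissipation.

Lemma frob2_cvg0 (R : realType) p q (M : nat -> 'M[R]_(p, q)) :
  ((fun k => frob2 (M k)) @ \oo --> (0 : R) -> M @ \oo --> (0 : 'M[R]_(p, q)))%classic.
Proof.
move=> /cvgr0Pnorm_lt M0; apply/cvgrPdist_lt => d d0.
near=> k; rewrite sub0r normrN /Num.norm /= mx_normrE.
apply: bigmax_lt => // -[i j] _ /=.
rewrite -(@ltr_pXn2r _ 2) ?nnegrE ?(ltW d0) // real_normK ?num_real //.
apply: le_lt_trans (sqr_entry_le_frob2 _ _ _) _.
rewrite -[frob2 _]ger0_norm ?frob2_ge0 //; near: k.
by apply: M0; rewrite exprn_gt0.
Unshelve. all: by end_near. Qed.

(** * Stacked vectors as matrices *)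

Section Unstack.
Variable R : realType.

(** Stacking is undone so that a Kronecker product acts by multiplication on
    both sides: column [i] is the state of agent [i]. *)
Definition unstack p n (x : 'cV[R]_(p * n)) : 'M[R]_(n, p) :=
  \matrix_(j, i) x (mxtens_index (i, j)) 0.

Lemma unstack_inj p n : injective (@unstack p n).
Proof.
move=> x y /matrixP xy; apply/matrixP => k l; rewrite [l]ord1.
by case: (mxtens_indexP k) => i j; have := xy j i; rewrite !mxE.
Qed.

Lemma unstackB p n (x y : 'cV[R]_(p * n)) : unstack (x - y) = unstack x - unstack y.
Proof. by apply/matrixP => i j; rewrite !mxE. Qed.

Lemma unstackZ p n c (x : 'cV[R]_(p * n)) : unstack (c *: x) = c *: unstack x.
Proof. by apply/matrixP => i j; rewrite !mxE. Qed.

Lemma col_unstack p n (x : 'cV[R]_(p * n)) i : col i (unstack x) = agent x i.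
Proof. by apply/matrixP => j k; rewrite !mxE. Qed.

Lemma sum_mxtens_index p n (f : 'I_(p * n) -> R) :
  \sum_k f k = \sum_i \sum_j f (mxtens_index (i, j)).
Proof.
rewrite pair_big /= (reindex (@mxtens_index p n)) /=; first by apply: eq_bigr => -[].
by exists (@mxtens_unindex p n) => k _; rewrite (mxtens_indexK, mxtens_unindexK).
Qed.

Lemma unstack_tensmx p q n m (P : 'M[R]_(q, p)) (Q : 'M[R]_(m, n))
    (x : 'cV[R]_(p * n)) :
  unstack (tensmx P Q *m x) = Q *m unstack x *m P^T.
Proof.
apply/matrixP => j i; rewrite !mxE sum_mxtens_index; apply: eq_bigr => l _.
rewrite !mxE mulr_suml; apply: eq_bigr => h _.
by rewrite tensmxE mxE -mulrA mulrC.
Qed.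

Lemma enorm_unstack p n (x : 'cV[R]_(p * n)) : enorm x ^+ 2 = frob2 (unstack x).
Proof.
rewrite enorm_sqr sum_mxtens_index frob2E exchange_big.
by apply: eq_bigr => i _; apply: eq_bigr => j _; rewrite mxE.
Qed.

Lemma unstack_network p n m (A : 'M[R]_n) (B : 'M[R]_(n, m)) F mu (L : 'M[R]_p)
    (x : 'cV[R]_(p * n)) :
  unstack (network_mx A B F mu L *m x) =
  A *m unstack x - mu *: (B *m F *m unstack x *m L^T).
Proof.
by rewrite mulmxBl -scalemxAl unstackB unstackZ !unstack_tensmx trmx1 mulmx1.
Qed.

End Unstack.

(** * Laplacians and their reduction *)

Section Reduction.
Variable R : realType.

Lemma laplacian_const N (a : 'M[R]_N) : (forall i, a i i = 0) ->
  laplacian a *m (const_mx 1 : 'cV_N) = 0.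
Proof.
move=> a0; apply/matrixP => i j; rewrite !mxE.
under eq_bigr do rewrite !mxE mulr1.
rewrite (bigD1 i) //= eqxx (bigD1 (F := a i) i) //= a0 add0r -big_split /=.
by apply: big1 => l; rewrite eq_sym => /negbTE ->; rewrite subrr.
Qed.

Lemma orthonormal_completion_gram N (V : 'M[R]_(N, N.-1)) :
  orthonormal_completion V -> V^T *m V = 1%:M.
Proof.
rewrite /orthonormal_completion tr_row_mx mul_col_row scalar_mx_block.
by case/eq_block_mx.
Qed.

(** The square matrix [v_1 V] is an isometry, hence a coisometry: removing the
    consensus direction from the identity leaves [V V']. *)
Lemma orthonormal_completion_proj N (V : 'M[R]_(N, N.-1)) : (0 < N)%N ->
  orthonormal_completion V -> V *m V^T = 1%:M - const_mx (N%:R^-1).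
Proof.
case: N V => // N V _ /mulmx1C; rewrite tr_row_mx mul_row_col => <-.
rewrite (_ : const_mx (Num.sqrt _)^-1 *m _ = const_mx N.+1%:R^-1); last first.
  by apply/matrixP => i j; rewrite !mxE big_ord1 !mxE -invfM -expr2 sqr_sqrtr.
by rewrite addrAC subrr add0r.
Qed.

(** Compressing [L'L] to the disagreement space yields [Lh' Lh] plus the Gram
    matrix of the part of [L V] that points in the consensus direction, so the
    reduced inequality follows from the full one with something to spare. *)
Lemma loewner_reduced N (V : 'M[R]_(N, N.-1)) (L : 'M[R]_N) (nu : R) :
  (0 < N)%N -> orthonormal_completion V -> 0 <= nu ->
  loewner_le (nu *: (L^T *m L)) (L + L^T) ->
  let Lh := reduced_laplacian V L in
  loewner_le (nu *: (Lh^T *m Lh)) (Lh + Lh^T).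
Proof.
move=> N0 Vo nu0 LL Lh.
pose P : 'M[R]_N := const_mx N%:R^-1.
have VV : V *m V^T = 1%:M - P := orthonormal_completion_proj N0 Vo.
(* P averages over the nodes: it is an orthogonal projection. *)
have PP : P^T *m P = P.
  apply/matrixP => i j; rewrite !mxE; under eq_bigr do rewrite !mxE.
  rewrite sumr_const card_ord -mulrnAr -(mulr_natr N%:R^-1).
  by rewrite mulVf ?mulr1 // pnatr_eq0 -lt0n.
rewrite /loewner_le (_ : _ - _ = V^T *m (L + L^T - nu *: (L^T *m L)) *m V
    + nu *: ((P *m L *m V)^T *m (P *m L *m V))).
  by apply: psdD; [exact: psd_congr | apply/psdZ/psd_gram].
rewrite /Lh /reduced_laplacian !trmx_mul trmxK -!mulmxA.
rewrite [P^T *m _]mulmxA PP [V *m (V^T *m _)]mulmxA VV.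
rewrite !(mulmxDl, mulmxDr, mulmxBl, mulmxBr) !(mulmxN, mulNmx, mul1mx).
rewrite -!(scalemxAl, scalemxAr) !scalerBr -!mulmxA.
by rewrite opprB addrA addrAC.
Qed.

(** [V V'] differs from the identity by averaging, and [L] kills averages, so no
    consensus component feeds back into the disagreement. *)
Lemma reduction_intertwines N (V : 'M[R]_(N, N.-1)) (L : 'M[R]_N) :
  (0 < N)%N -> orthonormal_completion V -> L *m (const_mx 1 : 'cV_N) = 0 ->
  reduced_laplacian V L *m V^T = V^T *m L.
Proof.
move=> N0 Vo L1; rewrite /reduced_laplacian -[_ *m V *m _]mulmxA.
rewrite orthonormal_completion_proj // mulmxBr mulmx1.
rewrite (_ : const_mx _ = (const_mx 1 : 'cV_N) *m (const_mx N%:R^-1 : 'rV_N)); last first.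
  by apply/matrixP => i j; rewrite !mxE big_ord1 !mxE mul1r.
by rewrite mulmxA -[_ *m L *m _]mulmxA L1 mulmx0 mul0mx subr0.
Qed.

(** In [|y - mu L y|^2] the cross term is governed by [L + L'], which pays for
    [nu] copies of [|L y|^2] while the square term costs [mu] of them.  The rows
    of [Y] are independent copies of [y]. *)
Lemma coupling_gain N m (L : 'M[R]_N) (nu mu : R) (Y : 'M[R]_(m, N)) :
  0 <= mu -> loewner_le (nu *: (L^T *m L)) (L + L^T) ->
  frob2 (Y - mu *: (Y *m L^T)) <= frob2 Y - mu * (nu - mu) * frob2 (Y *m L^T).
Proof.
move=> mu0 /(psd_mxtrace_ge0 Y^T); rewrite trmxK.
have e1 : \tr (Y *m L^T *m Y^T) = \tr (Y^T *m (Y *m L^T)) by rewrite mxtrace_mulC.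
have e2 : \tr (Y *m L *m Y^T) = \tr (Y^T *m (Y *m L^T)).
  by rewrite -e1 -mxtrace_tr !trmx_mul trmxK mulmxA.
have e3 : \tr (Y *m (L^T *m L) *m Y^T) = frob2 (Y *m L^T).
  by rewrite -frob2_tr /frob2 trmxK trmx_mul trmxK !mulmxA.
rewrite mulmxBr mulmxDr mulmxBl mulmxDl -scalemxAr -scalemxAl raddfB /=.
rewrite mxtraceD mxtraceZ e1 e2 e3 frob2_subZ => h.
by have := mulr_ge0 mu0 h; lra.
Qed.

End Reduction.

(** * Consensus *)

Lemma reduced_trajectory (R : realType) N n m (A : 'M[R]_n) (B : 'M[R]_(n, m)) F mu
    (L : nat -> 'M[R]_N) (V : 'M[R]_(N, N.-1)) (x : nat -> 'cV[R]_(N * n)) :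
  (0 < N)%N -> orthonormal_completion V ->
  (forall k, L k *m (const_mx 1 : 'cV_N) = 0) ->
  trajectory (fun k => network_mx A B F mu (L k)) x ->
  trajectory (fun k => network_mx A B F mu (reduced_laplacian V (L k)))
    (fun k => tensmx V^T 1%:M *m x k).
Proof.
move=> N0 Vo L1 xt k; apply: unstack_inj.
rewrite unstack_network !unstack_tensmx trmxK !mul1mx xt unstack_network mulmxBl.
rewrite -scalemxAl -!mulmxA; congr (_ - _ *: (_ *m (_ *m (_ *m _)))).
have := reduction_intertwines N0 Vo (L1 k).
by move=> /(congr1 trmx); rewrite !trmx_mul !trmxK.
Qed.

(** The nominal loop has unit coupling [u = - F z] for each agent; the deviation
    of the actual coupling from it enters through the same channel [B]. *)
Lemma network_feedbackE (R : realType) N n m (A : 'M[R]_n) (B : 'M[R]_(n, m)) F mu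
    (L : 'M[R]_N) (Z : 'M[R]_(n, N)) :
  A *m Z - mu *: (B *m F *m Z *m L^T) =
  (A - B *m F) *m Z + B *m (F *m Z - mu *: (F *m Z *m L^T)).
Proof. by rewrite mulmxBl mulmxBr -scalemxAr !mulmxA addrA subrK. Qed.

(** Averaging contributes the same column for every agent, so it cancels in
    differences. *)
Lemma disagreementE (R : realType) N n (V : 'M[R]_(N, N.-1)) (x : 'cV[R]_(N * n)) :
  (0 < N)%N -> orthonormal_completion V -> forall i j,
  agent x i - agent x j =
  col i (unstack x *m V *m V^T) - col j (unstack x *m V *m V^T).
Proof.
move=> N0 Vo i j; rewrite -mulmxA orthonormal_completion_proj // mulmxBr mulmx1.
set P := const_mx _.
have colP : col i (unstack x *m P) = col j (unstack x *m P).
  by apply/matrixP => r s; rewrite !mxE; apply: eq_bigr => l _; rewrite !mxE.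
rewrite [col i (_ - _)]linearB [col j (_ - _)]linearB /=.
by rewrite colP !col_unstack opprB addrA subrK.
Qed.

Theorem theorem2 (R : realType) (N n m : nat)
  (A : 'M[R]_n) (B : 'M[R]_(n, m))
  (a : nat -> 'M[R]_N) (L : nat -> 'M[R]_N) (Vhat : 'M[R]_(N, N.-1))
  (mubar mu gamma eps_gamma : R) (X : 'M[R]_n) (F : 'M[R]_(m, n))
  (Tc : nat) (eps : R)
  (hN : (2 <= N)%N)
  (hA : spectrum_on_unit_circle A)
  (hAB : reachable A B)
  (ha : forall k, edge_gains (a k))
  (hL : forall k, L k = laplacian (a k))
  (hmubar : 0 < mubar)
  (hLmu : forall k,
    loewner_le (mubar *: ((L k)^T *m L k)) (L k + (L k)^T))
  (hmu : 0 < mu < mubar)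
  (hV : orthonormal_completion Vhat)
  (hgamma : 1 < gamma)
  (heps_gamma : 0 < eps_gamma)
  (hX : stabilizing_riccati_solution A B gamma eps_gamma X)
  (hXpos : loewner_lt 0 X)
  (hBXB : loewner_lt (B^T *m X *m B) (gamma ^+ 2)%:M)
  (hF : F = riccati_gain A B gamma X)
  (hFstab : schur_stable (A - B *m F))
  (hTF : (Hinf_norm (transfer_matrix A B F) < gamma%:E)%E)
  (hTc : (0 < Tc)%N)
  (heps : 0 < eps)
  (hexc : forall xhat : nat -> 'cV[R]_(N.-1 * n),
    trajectory
      (fun k => network_mx A B F mu (reduced_laplacian Vhat (L k))) xhat ->
    let yhat := fun k : nat => tensmx 1%:M F *m xhat k in
    forall k0 : nat,
      eps * (\sum_(0 <= k < Tc.+1) enorm (yhat (k0 + k)%N) ^+ 2)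
      <= \sum_(0 <= k < Tc.+1)
           enorm (tensmx (reduced_laplacian Vhat (L (k0 + k)%N)) 1%:M
                  *m yhat (k0 + k)%N) ^+ 2)
  (hsmall : gamma * Num.sqrt (1 - eps * mu * (mubar - mu)) <= 1) :
  state_consensus (fun k => network_mx A B F mu (L k)).
Proof.
have N0 : (0 < N)%N by rewrite (leq_trans _ hN).
have [mu0 mumubar] := andP hmu.
have L1 k : L k *m (const_mx 1 : 'cV_N) = 0.
  by rewrite hL laplacian_const //; have [] := ha k.
have [_ riccati _] := hX.
have Xpsd : psd X by apply: pd_psd; rewrite -[X]subr0.
move=> x xt.
pose Lh k := reduced_laplacian Vhat (L k).
pose Z k := unstack (x k) *m Vhat.
pose Y k := F *m Z k.
pose W k := Y k - mu *: (Y k *m (Lh k)^T).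
have xht := reduced_trajectory N0 hV L1 xt.
have unstack_xh k : unstack (tensmx Vhat^T 1%:M *m x k) = Z k.
  by rewrite unstack_tensmx mul1mx trmxK.
have ZS k : Z k.+1 = (A - B *m F) *m Z k + B *m W k.
  by rewrite -network_feedbackE -!unstack_xh xht unstack_network.
have window k0 :
    \sum_(0 <= k < Tc.+1) (gamma ^+ 2 * frob2 (W (k0 + k)%N) - frob2 (Y (k0 + k)%N)) <= 0.
  have := hexc _ xht k0.
  under eq_bigr do rewrite enorm_unstack unstack_tensmx trmx1 mulmx1 unstack_xh -/(Y _).
  under [in leRHS]eq_bigr do rewrite enorm_unstack !unstack_tensmx trmx1 mulmx1 mul1mx
    -unstack_tensmx unstack_xh -/(Y _) -/(Lh _).
  set SY := \sum_(_ <= _ < _) _; set SL := \sum_(_ <= _ < _) _ => exc.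
  have SY0 : 0 <= SY by apply: sumr_ge0 => k _; exact: frob2_ge0.
  set SW := \sum_(0 <= k < Tc.+1) frob2 (W (k0 + k)%N).
  have SWle : SW <= SY - mu * (mubar - mu) * SL.
    rewrite [X in _ - X]mulr_sumr -sumrB; apply: ler_sum => k _.
    by apply: coupling_gain (ltW mu0) _; apply: loewner_reduced (ltW hmubar) _.
  rewrite sumrB -mulr_sumr -/SW -/SY subr_le0.
  set s := 1 - eps * mu * (mubar - mu) in hsmall.
  have g0 : 0 < gamma by rewrite (lt_trans _ hgamma).
  have s_le : gamma ^+ 2 * s <= 1.
    (* For s < 0 the square root in the hypothesis is 0 and carries no bound. *)
    have [s0|s0] := leP s 0.
      by rewrite (le_trans _ ler01) // mulr_ge0_le0 // sqr_ge0.
    rewrite -[s]sqr_sqrtr ?(ltW s0) // -exprMn exprn_ile1 //.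
    by rewrite mulr_ge0 ?sqrtr_ge0 // ltW.
  have SWs : SW <= s * SY.
    have mm : 0 <= mu * (mubar - mu) by rewrite mulr_ge0 ?subr_ge0 ?ltW.
    have := ler_wpM2l mm exc.
    by rewrite /s; lra.
  apply: (@le_trans _ _ (gamma ^+ 2 * s * SY)).
    by rewrite -mulrA ler_wpM2l // sqr_ge0.
  by rewrite ler_piMl.
have Z_cvg0 : ((fun k => frob2 (Z k)) @ \oo --> (0 : R))%classic.
  apply: (@windowed_dissipation_cvg0 _ eps_gamma (fun k => \tr ((Z k)^T *m X *m Z k))
    _ (fun k => gamma ^+ 2 * frob2 (W k) - frob2 (Y k)) _ _ _ Tc.+1 _ heps_gamma
    window) => // k; first exact: psd_mxtrace_ge0.
    exact: frob2_ge0.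
  have := riccati_dissipation hgamma Xpsd riccati (pd_psd hBXB).
  rewrite -hF => dissip.
  have {}dissip := dissip _ _ _ _ (ZS k).
  by rewrite [gamma ^+ 2 * _ - _]addrC addrA.
have col_cvg0 i :
    ((fun k => col i (Z k *m Vhat^T)) @ \oo --> (0 : 'cV[R]_n))%classic.
  apply: frob2_cvg0.
  apply: (@squeeze_cvgr _ _ _ _ (fun=> 0) (fun k => frob2 (Z k))) => //; last exact: cvg_cst.
  apply: nearW => k; rewrite frob2_ge0 /=.
  rewrite -(frob2_mul_isometry (Z k) (orthonormal_completion_gram hV)).
  rewrite !frob2E; apply: ler_sum => r _; rewrite big_ord1 mxE (bigD1 i) //= lerDl.
  by apply: sumr_ge0 => *; rewrite sqr_ge0.
move=> i j; under eq_fun do rewrite (disagreementE _ N0 hV).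
by rewrite -[0]subr0; apply: cvgB.
Qed.
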